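(* Let $\alpha\in[0,1)$, $V_{\alpha,0}\equiv 0$ and $n\in\mathbb{N}_0$. Then $V_{\alpha,n}(i,0)$ and $V_{\alpha,n}(i,1)$ are non-decreasing and convex in $i\in\mathbb{N}_0$. The policy $\phi_{\alpha,n}\in\Phi$ is of threshold form, i.e., there exists a threshold $i_{\alpha,n}\in\mathbb{N}_0\cup\{\infty\}$ such that $$\phi_{\alpha,n}(i,1)=\begin{cases}\mu_1 & \text{if } i\le i_{\alpha,n},\\ \mu_2 & \text{if } i>i_{\alpha,n}.\end{cases}$$
   Context: Model. Real parameters $\lambda,\beta>0$ and $0<\mu_1<\mu_2$ satisfy $\lambda+\mu_1+\mu_2+\beta=1$; service cost rates $0=c_{\mu_1}<c_{\mu_2}$; a fixed rate $\mu\in\{\mu_1,\mu_2\}$ with $\mu>\lambda$. The holding cost $h:\mathbb{N}_0\to\mathbb{R}$ satisfies $h(0)=0$, is non-negative, non-decreasing, convex (i.e. $h(i+1)-h(i)$ is non-decreasing in $i$), unbounded, and $\sum_{i\ge 0}h(i)x^i<\infty$ for all $0<x<1$. State space $S=\mathbb{N}_0\times\{0,1\}$. $\Phi$ is the set of stationary deterministic policies $\phi$, with $\phi(i,1)\in\{\mu_1,\mu_2\}$ and $\phi(i,0)=\mu$. Write $i^+=\max\{i,0\}$. Value Iteration (with discount parameter $\alpha\in[0,1)$). $V_{\alpha,0}\equiv0$ on $S$ and, for $n\ge 0$, $i\in\mathbb{N}_0$, $$V_{\alpha,n+1}(i,1)=h(i)+(1-\alpha)\big(\mu_1V_{\alpha,n}(i,1)+\mu_1V_{\alpha,n}((i-1)^+,1)+\lambda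 V_{\alpha,n}(i+1,1)+\beta V_{\alpha,n}(i,0)\big)+\min_{a\in\{\mu_1,\mu_2\}}\big\{c_a+(1-\alpha)\big((a-\mu_1)V_{\alpha,n}((i-1)^+,1)+(\mu_2-a)V_{\alpha,n}(i,1)\big)\big\},$$ $$V_{\alpha,n+1}(i,0)=c_\mu+h(i)+(1-\alpha)\big(\mu V_{\alpha,n}((i-1)^+,0)+(1-\mu-\lambda)V_{\alpha,n}(i,0)+\lambda V_{\alpha,n}(i+1,0)\big).$$ The policy $\phi_{\alpha,n+1}$ picks in $(i,1)$ the minimising action $a$ in the first formula, ties being resolved in favour of $\mu_1$; equivalently $\phi_{\alpha,n+1}(i,1)=\mu_1$ iff $V_{\alpha,n}(i,1)-V_{\alpha,n}((i-1)^+,1)\le \frac{c_{\mu_2}}{(1-\alpha)(\mu_2-\mu_1)}$. By convention $\phi_{\alpha,0}(i,1)=\mu_1$ for all $i$ (threshold $\infty$). *)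

(* Defs.v *)
From HB Require Import structures.
From mathcomp Require Import all_boot all_order all_algebra.
From mathcomp Require Import boolp classical_sets reals.
From mathcomp Require Import topology normedtype sequences exp.

Set Implicit Arguments.
Unset Strict Implicit.
Unset Printing Implicit Defensive.

Import Order.TTheory GRing.Theory Num.Theory.
Import numFieldNormedType.Exports.

Local Open Scope classical_set_scope.
Local Open Scope ring_scope.

Definition convex_seq (R : realType) (u : nat -> R) : Prop :=
  nondecreasing_seq (fun i => u i.+1 - u i).

(* [cost a] is the cost rate c_a of serving at rate [a]; it is only ever used
   at the rates [mu1] and [mu2]. *)
Record model (R : realType) := Model {
  lambda : R;
  beta : R;
  mu1 : R;
  mu2 : R;
  mu : R;
  cost : R -> R;
  h : nat -> R;
  lambda_gt0 : 0 < lambda;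
  beta_gt0 : 0 < beta;
  mu1_gt0 : 0 < mu1;
  mu1_lt_mu2 : mu1 < mu2;
  rates_sum1 : lambda + mu1 + mu2 + beta = 1;
  cost_mu1 : cost mu1 = 0;
  cost_mu2_gt0 : 0 < cost mu2;
  mu_mu1_or_mu2 : mu = mu1 \/ mu = mu2;
  lambda_lt_mu : lambda < mu;
  h0 : h 0%N = 0;
  h_ge0 : forall i, 0 <= h i;
  h_nondecreasing : nondecreasing_seq h;
  h_convex : convex_seq h;
  h_unbounded : ~ has_ubound (range h);
  h_summable : forall x : R, 0 < x -> x < 1 -> cvgn (pseries h x)
}.

(* [(i, true)] is the state (i,1) and [(i, false)] the state (i,0). *)
Definition state : Type := (nat * bool)%type.

(* The predecessor on [nat] is truncated, so [i.-1] is (i-1)^+. *)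
Definition action_cost (R : realType) (M : model R) (alpha : R)
    (v : state -> R) (i : nat) (a : R) : R :=
  cost M a + (1 - alpha) * ((a - mu1 M) * v (i.-1, true)
                            + (mu2 M - a) * v (i, true)).

Definition VI_step (R : realType) (M : model R) (alpha : R)
    (v : state -> R) (s : state) : R :=
  let: (i, m) := s in
  if m then
    h M i + (1 - alpha) * (mu1 M * v (i, true) + mu1 M * v (i.-1, true)
                           + lambda M * v (i.+1, true) + beta M * v (i, false))
    + Num.min (action_cost M alpha v i (mu1 M))
              (action_cost M alpha v i (mu2 M))
  else
    cost M (mu M) + h M i
    + (1 - alpha) * (mu M * v (i.-1, false)
                     + (1 - mu M - lambda M) * v (i, false)
                     + lambda M * v (i.+1, false)).

Fixpoint V (R : realType) (M : model R) (alpha : R) (n : nat) : state -> R :=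
  if n is n'.+1 then VI_step M alpha (V M alpha n') else fun _ => 0.

Definition Phi (R : realType) (M : model R) : set (state -> R) :=
  [set phi | forall i, (phi (i, true) = mu1 M \/ phi (i, true) = mu2 M)
                       /\ phi (i, false) = mu M].

(* The non-strict comparison resolves ties in favour of [mu1]. *)
Definition greedy (R : realType) (M : model R) (alpha : R)
    (v : state -> R) (s : state) : R :=
  let: (i, m) := s in
  if m then
    if action_cost M alpha v i (mu1 M) <= action_cost M alpha v i (mu2 M)
    then mu1 M else mu2 M
  else mu M.

Definition VI_policy (R : realType) (M : model R) (alpha : R) (n : nat) :
    state -> R :=
  if n is n'.+1 then greedy M alpha (V M alpha n')
  else fun s => if s.2 then mu1 M else mu M.

Lemma VI_policyP (R : realType) (M : model R) (alpha : R) (n i : nat) :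
  alpha < 1 ->
  VI_policy M alpha n.+1 (i, true) = mu1 M <->
  V M alpha n (i, true) - V M alpha n (i.-1, true)
    <= cost M (mu2 M) / ((1 - alpha) * (mu2 M - mu1 M)).
Proof.
move=> a1; rewrite /= /action_cost cost_mu1.
have d0 : 0 < (1 - alpha) * (mu2 M - mu1 M).
  by rewrite mulr_gt0 // subr_gt0 // mu1_lt_mu2.
rewrite ler_pdivlMr // !subrr !mul0r addr0 !add0r.
set x := V _ _ _ _; set y := V _ _ _ _.
have -> : ((1 - alpha) * ((mu2 M - mu1 M) * x)
  <= cost M (mu2 M) + (1 - alpha) * ((mu2 M - mu1 M) * y)) =
  ((x - y) * ((1 - alpha) * (mu2 M - mu1 M)) <= cost M (mu2 M)).
  by rewrite -lerBlDr -mulrBr -mulrBr mulrA mulrC.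
case: ifP => // _; split => // e.
by have := mu1_lt_mu2 M; rewrite e ltxx.
Qed.

(* A threshold in N_0 \cup {oo}; [None] is oo. *)
Definition le_threshold (i : nat) (t : option nat) : bool :=
  if t is Some k then (i <= k)%N else true.

(* Main.v *)
(* Write v(i) - v((i-1)^+) for the increment of v into i, which is 0 at i = 0.
   Monotonicity and convexity of v together say exactly that these increments
   are non-decreasing.  This property is stable under both shifts, non-negative
   combinations, and under v |-> min(v(i), c + v((i-1)^+)) for c >= 0: with d
   the increments of v, the increment of the minimum into i + 1 is
   max(d(i) - c, 0) + min(d(i+1), c).  Hence value iteration preserves it, and
   the rule "serve slowly iff d(i) <= C" defines an initial segment. *)
Require Import Defs.
From HB Require Import structures.
From mathcomp Require Import all_boot all_order all_algebra.
From mathcomp Require Import boolp classical_sets reals.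
From mathcomp Require Import topology normedtype sequences exp.
From mathcomp Require Import lra.

Set Implicit Arguments.
Unset Strict Implicit.
Unset Printing Implicit Defensive.

Import Order.TTheory GRing.Theory Num.Theory.
Import numFieldNormedType.Exports.

Local Open Scope classical_set_scope.
Local Open Scope ring_scope.

(* At [i = 0] this reads [v 0 <= v 1], because [0.-1 = 0]. *)
Definition monotone_convex (R : numDomainType) (v : nat -> R) : Prop :=
  forall i, v i - v i.-1 <= v i.+1 - v i.

Section MonotoneConvex.
Variable R : realFieldType.
Implicit Types (u v : nat -> R) (c k : R).

Lemma monotone_convexP v : monotone_convex v <->
  nondecreasing_seq v /\ nondecreasing_seq (fun i => v i.+1 - v i).
Proof.
split=> [mcv|[ndv cvxv] [|i]]; last exact: cvxv (leqnSn i); last first.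
  by rewrite subrr subr_ge0; exact: ndv.
(* The increment into 0 vanishes, so the increasing chain of increments starts at 0: this is where
   monotonicity comes from. *)
have incr_ge0 i : 0 <= v i.+1 - v i.
  by elim: i => [|i IH]; [have := mcv 0 | have := mcv i.+1]; move=> /=; lra.
split; apply/nondecreasing_seqP => i; first by rewrite -subr_ge0.
exact: mcv i.+1.
Qed.

Lemma monotone_convex_incr v : monotone_convex v ->
  nondecreasing_seq (fun i => v i - v i.-1).
Proof. by move=> mcv; apply/nondecreasing_seqP => i; exact: mcv. Qed.

Lemma monotone_convex_cst c : monotone_convex (fun=> c).
Proof. by move=> i. Qed.

Lemma monotone_convexD u v : monotone_convex u -> monotone_convex v ->
  monotone_convex (fun i => u i + v i).
Proof. by move=> mcu mcv i; have := mcu i; have := mcv i; lra. Qed.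

Lemma monotone_convexZ k v : 0 <= k -> monotone_convex v ->
  monotone_convex (fun i => k * v i).
Proof. by move=> k0 mcv i; rewrite -!mulrBr ler_wpM2l. Qed.

Lemma monotone_convex_pred v : monotone_convex v ->
  monotone_convex (fun i => v i.-1).
Proof. by move=> mcv [|i]; [rewrite subrr | exact: mcv]. Qed.

Lemma monotone_convex_succ v : monotone_convex v ->
  monotone_convex (fun i => v i.+1).
Proof.
move=> mcv [|i]; last exact: mcv.
(* Here [0.-1.+1] is 1, not 0, so the goal is [v 1 <= v 2], obtained from the chain of increments
   [0 <= v 1 - v 0 <= v 2 - v 1]. *)
by have := mcv 0; have := mcv 1 => /=; lra.
Qed.

Lemma monotone_convex_min c v : 0 <= c -> monotone_convex v ->
  monotone_convex (fun i => Num.min (v i) (c + v i.-1)).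
Proof.
move=> c0 mcv i; have := mcv i; have := mcv i.-1.
(* The goal bounds twice the middle minimum by the sum of its neighbours, so upper bounds on it
   suffice; only the two outer minima are split. *)
have mid1 : Num.min (v i) (c + v i.-1) <= v i by rewrite ge_min lexx.
have mid2 : Num.min (v i) (c + v i.-1) <= c + v i.-1.
  by rewrite ge_min lexx orbT.
move: (Num.min (v i) _) mid1 mid2 => w; case: i => [|i] /= mid1 mid2 mcv1 mcv2.
  by case: (leP (v 0)) => ?; case: (leP (v 1)) => ?; lra.
by case: (leP (v i)) => ?; case: (leP (v i.+2)) => ?; lra.
Qed.

End MonotoneConvex.

Section ValueIteration.
Variables (R : realType) (M : model R) (alpha : R).
Hypothesis (alpha_lt1 : alpha < 1).
Implicit Type v : state -> R.

Let discount_ge0 : 0 <= 1 - alpha. Proof. by rewrite subr_ge0 ltW. Qed.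

Lemma monotone_convex_h : monotone_convex (h M).
Proof.
by apply/monotone_convexP; split; [exact: h_nondecreasing | exact: h_convex].
Qed.

(** Makes the weight of staying in [(i, false)] non-negative. It holds because either choice of
    [mu M] is at most [mu2 M]. *)
Lemma mu_addr_lambda_le1 : mu M + lambda M <= 1.
Proof.
have := rates_sum1 M; have := beta_gt0 M; have := mu1_gt0 M.
by have := mu1_lt_mu2 M; case: (mu_mu1_or_mu2 M) => ->; lra.
Qed.

(** With [w] the rescaled value function, the two action costs become [w i] and [c + w i.-1], the
    shape required by [monotone_convex_min]. *)
Lemma action_cost_mu1 v i : action_cost M alpha v i (mu1 M) =
  (1 - alpha) * (mu2 M - mu1 M) * v (i, true).
Proof. by rewrite /action_cost cost_mu1 subrr mul0r !add0r mulrA. Qed.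

Lemma action_cost_mu2 v i : action_cost M alpha v i (mu2 M) =
  cost M (mu2 M) + (1 - alpha) * (mu2 M - mu1 M) * v (i.-1, true).
Proof. by rewrite /action_cost subrr mul0r addr0 mulrA. Qed.

(** Both modes are treated together because the update at [(i, true)] also uses the value at
    [(i, false)], with weight [beta M]. *)
Lemma monotone_convex_VI_step v :
  (forall m, monotone_convex (fun i => v (i, m))) ->
  forall m, monotone_convex (fun i => VI_step M alpha v (i, m)).
Proof.
move=> mcv m.
have la0 := lambda_gt0 M; have be0 := beta_gt0 M.
have m10 := mu1_gt0 M; have m12 := mu1_lt_mu2 M.
have la_mu := lambda_lt_mu M; have mu_la_le1 := mu_addr_lambda_le1.
case: m => /=.
  under [X in monotone_convex X]eq_fun => i
    do rewrite action_cost_mu1 action_cost_mu2.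
  apply: monotone_convexD.
    apply: monotone_convexD; first exact: monotone_convex_h.
    apply: monotone_convexZ => //; apply: monotone_convexD; last first.
      by apply: monotone_convexZ => //; lra.
    apply: monotone_convexD.
      apply: monotone_convexD; first by apply: monotone_convexZ => //; lra.
      by apply: monotone_convexZ; [lra | exact: monotone_convex_pred (mcv _)].
    by apply: monotone_convexZ; [lra | exact: monotone_convex_succ (mcv _)].
  apply: (monotone_convex_min (ltW (cost_mu2_gt0 M))
    (v := fun i => (1 - alpha) * (mu2 M - mu1 M) * v (i, true))).
  by apply: monotone_convexZ => //; rewrite mulr_ge0 // subr_ge0 ltW.
apply: monotone_convexD.
  by apply: monotone_convexD monotone_convex_h; exact: monotone_convex_cst.
apply: monotone_convexZ => //; apply: monotone_convexD.
  apply: monotone_convexD; last by apply: monotone_convexZ => //; lra.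
  by apply: monotone_convexZ; [lra | exact: monotone_convex_pred (mcv _)].
by apply: monotone_convexZ; [lra | exact: monotone_convex_succ (mcv _)].
Qed.

Lemma monotone_convex_V n m : monotone_convex (fun i => V M alpha n (i, m)).
Proof.
elim: n m => [|n IH] m; first exact: monotone_convex_cst.
exact: monotone_convex_VI_step.
Qed.

Lemma VI_policy_in_Phi n : Phi M (VI_policy M alpha n).
Proof.
by case: n => [|n] i /=; split=> //; [left | case: ifP; [left | right]].
Qed.

End ValueIteration.

(* [p 0] is needed because no threshold encodes the empty initial segment. *)
Lemma initial_segment_threshold (p : pred nat) :
  p 0 -> (forall i j, (i <= j)%N -> p j -> p i) ->
  exists t : option nat, forall i, p i = le_threshold i t.
Proof.
move=> p0 p_down; have [ex|nex] := pselect (exists i, ~~ p i); last first.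
  by exists None => i; apply/negPn/negP => npi; apply: nex; exists i.
(* The least failing index is positive by [p 0]; its predecessor is the threshold. *)
case: (ex_minnP ex) => -[|m] npm m_min; first by rewrite p0 in npm.
exists (Some m) => i /=; case: leqP => [le_im | lt_mi].
  by apply: contraLR le_im => /m_min; rewrite -ltnNge.
by apply: contraNF npm; exact: p_down.
Qed.

Theorem proposition3p1 (R : realType) (M : model R) (alpha : R)
    (alpha_ge0 : 0 <= alpha) (alpha_lt1 : alpha < 1) (n : nat) :
  (nondecreasing_seq (fun i => V M alpha n (i, false)) /\
   convex_seq (fun i => V M alpha n (i, false))) /\
  (nondecreasing_seq (fun i => V M alpha n (i, true)) /\
   convex_seq (fun i => V M alpha n (i, true))) /\
  Phi M (VI_policy M alpha n) /\
  exists t : option nat, forall i : nat,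
    VI_policy M alpha n (i, true) =
    if le_threshold i t then mu1 M else mu2 M.
Proof.
have mcV := monotone_convex_V M alpha_lt1.
split; first exact/monotone_convexP/(mcV n false).
split; first exact/monotone_convexP/(mcV n true).
split; first exact: VI_policy_in_Phi.
case: n => [|n]; first by exists None.
have k_ge0 : 0 <= (1 - alpha) * (mu2 M - mu1 M).
  by rewrite mulr_ge0 // subr_ge0 ltW // mu1_lt_mu2.
pose slow i := action_cost M alpha (V M alpha n) i (mu1 M)
  <= action_cost M alpha (V M alpha n) i (mu2 M).
(* The greedy test compares a scaled increment of the value function with a constant, so passing it
   at [j] implies passing it at every [i <= j]. *)
have slowE i : slow i = ((1 - alpha) * (mu2 M - mu1 M)
    * (V M alpha n (i, true) - V M alpha n (i.-1, true)) <= cost M (mu2 M)).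
  by rewrite /slow action_cost_mu1 action_cost_mu2 -lerBlDr -mulrBr.
have [||t slow_t] := @initial_segment_threshold slow.
(* At 0 the increment is 0, so the test reads [0 <= cost M (mu2 M)]. *)
- by rewrite slowE subrr mulr0 ltW // cost_mu2_gt0.
- move=> i j le_ij; rewrite !slowE; apply: le_trans.
  by rewrite ler_wpM2l //; exact: monotone_convex_incr (mcV n true) _ _ le_ij.
by exists t => i; rewrite -slow_t.
Qed.
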